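(* Let $X_1,\dots,X_n$ be random variables whose joint cdf is absolutely continuous with respect to the product of their one-dimensional marginal cdf's, let $\xi_1,\dots,\xi_n$ be independent random variables such that $\xi_k$ has the same distribution as $X_k$, $k=1,\dots,n$, and let $h:\mathbf R^n\to\mathbf R$ be an arbitrary Borel measurable function. Then for all $x\in\mathbf R$ the following inequalities hold: $$P(h(X_1,\dots,X_n)>x)\le P(h(\xi_1,\dots,\xi_n)>x)+\phi_{X_1,\dots,X_n}\big(P(h(\xi_1,\dots,\xi_n)>x)\big)^{1/2},$$ $$P(h(X_1,\dots,X_n)>x)\le\big(1+\phi^2_{X_1,\dots,X_n}\big)^{1/2}\big(P(h(\xi_1,\dots,\xi_n)>x)\big)^{1/2},$$ $$P(h(X_1,\dots,X_n)>x)\le(e-1)P(h(\xi_1,\dots,\xi_n)>x)+\delta_{X_1,\dots,X_n},$$ $$P(h(X_1,\dots,X_n)>x)\le\big(1+D^\psi_{X_1,\dots,X_n}\big)^{1-\frac1q}\big(P(h(\xi_1,\dots,\xi_n)>x)\big)^{1/q},\quad q>1,$$ where in the last inequality $\psi(x)=|x|^{q/(q-1)}-1$.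
   Context: Let $F$ be the joint cdf and $F_1,\dots,F_n$ the marginal cdf's of $X_1,\dots,X_n$, and let $G=\frac{dF}{dF_1\cdots dF_n}\ge0$ be the density of the joint distribution with respect to the product of marginals (taken to be $1$ outside the support of $dF_1\cdots dF_n$). Define the multivariate Pearson coefficient $\phi^2_{X_1,\dots,X_n}=\int_{\mathbf R^n}G^2\prod_{i=1}^ndF_i-1$, $\phi_{X_1,\dots,X_n}=(\phi^2_{X_1,\dots,X_n})^{1/2}$; the relative entropy $\delta_{X_1,\dots,X_n}=\int_{\mathbf R^n}\log(G)\,dF$; and the multivariate divergence measure $D^\psi_{X_1,\dots,X_n}=\int_{\mathbf R^n}\psi(G)\prod_{i=1}^ndF_i$. All quantities may be $+\infty$, with the convention $0\cdot\infty=0$. *)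

(* Defs.v *)
From HB Require Import structures.
From mathcomp Require Import all_boot all_order all_algebra.
From mathcomp Require Import all_classical all_reals all_analysis.

Set Implicit Arguments.
Unset Strict Implicit.
Unset Printing Implicit Defensive.

Import Order.TTheory GRing.Theory Num.Theory.
Import numFieldNormedType.Exports.

Local Open Scope classical_set_scope.
Local Open Scope ring_scope.
Local Open Scope ereal_scope.

(* R^n is n.-tuple R with its library sigma-algebra, generated by the
   coordinate maps into R with the Borel sigma-algebra; since R is second
   countable this is the Borel sigma-algebra of R^n. *)

Definition tuple_cons (R : realType) (n : nat) (p : R * n.-tuple R) :
  n.+1.-tuple R := [tuple of p.1 :: p.2].

Lemma measurable_tuple_cons (R : realType) (n : nat) :
  measurable_fun [set: R * n.-tuple R] (@tuple_cons R n).
Proof. exact: measurable_cons. Qed.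

HB.instance Definition _ (R : realType) (n : nat) :=
  isMeasurableFun.Build _ _ _ _ (@tuple_cons R n)
    (@measurable_tuple_cons R n).

Fixpoint product_prob (R : realType) (n : nat) :
    ('I_n -> probability R R) -> probability (n.-tuple R) R :=
  match n with
  | 0%N => fun=> dirac [tuple]
  | m.+1 => fun mu =>
      distribution (mu ord0 \x product_prob (fun i => mu (lift ord0 i)))
        (@tuple_cons R m)
  end.

Section random_vector.
Context (d : measure_display) (T : measurableType d) (R : realType)
  (P : probability T R) (n : nat).

Definition random_vector (X : 'I_n -> {RV P >-> R}) (w : T) : n.-tuple R :=
  [tuple X i w | i < n].

Lemma measurable_random_vector (X : 'I_n -> {RV P >-> R}) :
  measurable_fun [set: T] (random_vector X).
Proof.
apply/measurable_fun_tnthP => i.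
have -> : (@tnth n R)^~ i \o random_vector X = X i.
  by apply/funext => w; rewrite /= tnth_mktuple.
exact: measurable_funPT.
Qed.

HB.instance Definition _ (X : 'I_n -> {RV P >-> R}) :=
  isMeasurableFun.Build _ _ _ _ (random_vector X)
    (measurable_random_vector X).

(* dF *)
Definition joint_law (X : 'I_n -> {RV P >-> R}) : probability (n.-tuple R) R :=
  distribution P (random_vector X).

(* dF_1 ... dF_n *)
Definition marginal_product (X : 'I_n -> {RV P >-> R}) :
    probability (n.-tuple R) R :=
  product_prob (fun i => distribution P (X i)).

Definition independent_RVs (X : 'I_n -> {RV P >-> R}) :=
  forall (J : {set 'I_n}) (A : 'I_n -> set R),
    (forall i, i \in J -> measurable (A i)) ->
    P (\bigcap_(i in [set` J]) (X i @^-1` A i)) =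
    \prod_(i in J) P (X i @^-1` A i).

End random_vector.

Definition msupport (R : realType) (n : nat)
    (mu : set (n.-tuple R) -> \bar R) : set (n.-tuple R) :=
  [set t | forall e : R, (0 < e)%R ->
    0 < mu [set s | forall i, (`|tnth s i - tnth t i| < e)%R]].

(* G is a version of dF/(dF_1 ... dF_n); every integral below is the same
   for all versions. *)
Definition is_density (d : measure_display) (T : measurableType d)
    (R : realType) (P : probability T R) (n : nat)
    (X : 'I_n -> {RV P >-> R}) (G : n.-tuple R -> R) :=
  [/\ measurable_fun [set: n.-tuple R] G,
      (forall t, (0 <= G t)%R),
      (forall A, measurable A ->
        joint_law X A = \int[marginal_product X]_(t in A) (G t)%:E) &
      (forall t, ~ msupport (marginal_product X) t -> G t = 1%R)].

Section dependence_measures.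
Context (d : measure_display) (T : measurableType d) (R : realType)
  (P : probability T R) (n : nat).
Variables (X : 'I_n -> {RV P >-> R}) (G : n.-tuple R -> R).

Definition pearson2 : \bar R :=
  \int[marginal_product X]_t ((G t) ^+ 2)%:E - 1.

Definition pearson : \bar R := sqrte pearson2.

(* lne 0 = -oo, but G > 0 almost everywhere for the joint law. *)
Definition relative_entropy : \bar R :=
  \int[joint_law X]_t lne (G t)%:E.

Definition divergence (psi : R -> R) : \bar R :=
  \int[marginal_product X]_t (psi (G t))%:E.

End dependence_measures.

(* Main.v *)
(** The vectors [(X_i)] and [(xi_i)] push [P] and [P'] to [nu = joint_law X] and
    [mu = marginal_product X], so with [A = {h > x}] the claims compare
    [nu A], the integral of [G] over [A] against [mu], with [mu A].  Hoelder's
    inequality for [G - 1] and for [G] against the indicator of [A] gives the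
    Pearson and divergence bounds; with [E] the [mu]-integral,
    [E (G - 1)^2 = E G^2 - 1] since [G] has mean [1].  The entropy bound
    integrates [1 + 1_A <= ln G + exp (1_A) / G] against [nu], where the last
    term contributes at most [E exp (1_A) = 1 + (e - 1) * mu A]. *)

Require Import Defs.
From HB Require Import structures.
From mathcomp Require Import all_boot all_order all_algebra.
From mathcomp Require Import all_classical all_reals all_analysis.
From mathcomp Require Import measurable_realfun ring lra.

Set Implicit Arguments.
Unset Strict Implicit.
Unset Printing Implicit Defensive.

Import Order.TTheory GRing.Theory Num.Theory.
Import numFieldNormedType.Exports.

Local Open Scope classical_set_scope.
Local Open Scope ring_scope.
Local Open Scope ereal_scope.

(** * Boxes, product measures and independence *)

Definition box (T : Type) (n : nat) (A : 'I_n -> set T) : set (n.-tuple T) :=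
  [set t | forall i, A i (tnth t i)].

Lemma measurable_box (d : measure_display) (T : measurableType d) (n : nat)
    (A : 'I_n -> set T) :
  (forall i, measurable (A i)) -> measurable (box A).
Proof.
move=> mA.
rewrite (_ : box A = \bigcap_(i in [set: 'I_n]) ((@tnth n T)^~ i @^-1` A i)).
  apply: fin_bigcap_measurable => [|i _]; first exact: finite_finset.
  by rewrite -[X in measurable X]setTI; exact: measurable_tnth.
by apply/seteqP; split => t tA i; [move=> _; exact: tA|exact: tA].
Qed.

(** The library sigma-algebra on tuples is generated by preimages of single coordinates. Such a
    preimage is a box whose other sides are full, and a measurable box is a finite intersection of
    such preimages. *)
Lemma sigma_box (d : measure_display) (T : measurableType d) (n : nat) :
  @measurable _ (n.-tuple T) =
  <<s [set box A | A in [set A : 'I_n -> set T | forall i, measurable (A i)]] >>.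
Proof.
apply/seteqP; split.
  apply: smallest_sub; first exact: smallest_sigma_algebra.
  apply: (big_ind (fun S => S `<=` _)) => // [S S' SG S'G|i _ _ [A mA <-]].
    by rewrite subUset.
  apply: sub_sigma_algebra; exists (fun j => if j == i then A else setT).
    by move=> j; case: ifP.
  rewrite setTI; apply/seteqP; split => t /=.
    by move=> /(_ i); rewrite eqxx.
  by move=> At j; case: eqP => // ->.
apply: smallest_sub; first exact: sigma_algebra_measurable.
by move=> _ [A mA <-]; exact: measurable_box.
Qed.

(** Boxes are stable under intersection and generate the sigma-algebra, so uniqueness of measures
    applies, with the whole space as a cover of finite mass. *)
Lemma eq_measure_box (d : measure_display) (T : measurableType d) (R : realType)
    (n : nat) (m1 m2 : probability (n.-tuple T) R) :
  (forall A : 'I_n -> set T, (forall i, measurable (A i)) ->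
    m1 (box A) = m2 (box A)) ->
  forall B, measurable B -> m1 B = m2 B.
Proof.
move=> m12 B mB.
apply: (measure_unique _ (fun=> setT) (sigma_box T n)) => //.
- move=> _ _ [A mA <-] [C mC <-]; exists (fun i => A i `&` C i).
    by move=> i; apply: measurableI; [exact: mA|exact: mC].
  apply/seteqP; split => [t tAC|t [tA tC] i]; last by split; [exact: tA|exact: tC].
  by split => i; have [] := tAC i.
- by move=> _; exists (fun=> setT) => //; apply/seteqP.
- by rewrite bigcup_const.
- by move=> _ [A mA <-]; exact: m12.
- by move=> _; rewrite /= probability_setT ltry.
Qed.

(** Induction on [n]: along [tuple_cons] a box pulls back to the rectangle formed by its first side
    and the box of the remaining sides. *)
Lemma product_prob_box (R : realType) (n : nat) (mu : 'I_n -> probability R R)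
    (A : 'I_n -> set R) :
  (forall i, measurable (A i)) ->
  product_prob mu (box A) = \prod_(i < n) mu i (A i).
Proof.
elim: n => [|n IH] in mu A *.
  move=> _; rewrite big_ord0 /= diracE mem_set//.
  by case.
move=> mA; rewrite big_ord_recl /= /pushforward.
rewrite (_ : _ @^-1` _ = A ord0 `*` box (fun i => A (lift ord0 i))).
  rewrite product_measure1E//; last exact: measurable_box.
  by congr (_ * _); exact: (IH (fun i => mu (lift ord0 i))).
apply/seteqP; split => [[a t] /= tA|[a t] /= [aA tA] i].
  split; first by have := tA ord0; rewrite tnth0.
  by move=> i; have := tA (lift ord0 i); rewrite tnthS.
by case: (unliftP ord0 i) => [j ->|->]; rewrite ?tnthS ?tnth0//; exact: tA.
Qed.

Lemma independent_joint_law (R : realType) (n : nat)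
    (d : measure_display) (T : measurableType d) (P : probability T R)
    (X : 'I_n -> {RV P >-> R}) (mu : 'I_n -> probability R R) :
  independent_RVs X ->
  (forall k A, measurable A -> distribution P (X k) A = mu k A) ->
  forall B, measurable B -> joint_law X B = product_prob mu B.
Proof.
move=> indX lawX; apply: eq_measure_box => A mA.
rewrite product_prob_box//.
(* Independence is used with [J] the full index set, where the intersection is the preimage of the
   box. *)
transitivity (P (\bigcap_(i in [set` [set: 'I_n]%SET]) (X i @^-1` A i))).
  rewrite /joint_law /distribution/= /pushforward; congr (P _).
  apply/seteqP; split => w /= wA i; first by move=> _; have := wA i; rewrite tnth_mktuple.
  by rewrite tnth_mktuple; apply: wA; rewrite /= inE.
rewrite indX; last by move=> i _; exact: mA.
by under eq_bigl do rewrite inE; apply: eq_bigr => i _; rewrite -lawX.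
Qed.

(** * Integration against a density *)

(* Unlike in [integralB], [f] may have an infinite integral. *)
Lemma ge0_integralB (d : measure_display) (T : measurableType d) (R : realType)
    (mu : {measure set T -> \bar R}) (f g : T -> R) :
  measurable_fun [set: T] f -> measurable_fun [set: T] g ->
  (forall x, (0 <= f x)%R) -> (forall x, (0 <= g x)%R) ->
  \int[mu]_x (g x)%:E < +oo ->
  \int[mu]_x (f x - g x)%:E = \int[mu]_x (f x)%:E - \int[mu]_x (g x)%:E.
Proof.
move=> mf mg f0 g0 goo; pose h : T -> \bar R := fun x => (f x - g x)%:E.
have mh : measurable_fun setT h.
  by apply/measurable_EFinP; exact: measurable_funB.
(* The negative part of [f - g] is dominated by [g], hence has a finite integral. *)
have hg x : h^\- x <= (g x)%:E.
  by rewrite funenegE /h -EFinN opprB -EFin_max lee_fin ge_max lerBlDr lerDl f0 g0.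
have fin_g : \int[mu]_x (g x)%:E \is a fin_num.
  by rewrite ge0_fin_numE// integral_ge0// => x _; rewrite lee_fin.
have fin_h : \int[mu]_x h^\- x \is a fin_num.
  rewrite ge0_fin_numE ?integral_ge0//; apply: le_lt_trans goo.
  apply: ge0_le_integral => //.
  - exact: measurable_funeneg.
  - exact/measurable_EFinP.
(* The identity [f - g = h^\+ - h^\-] is rearranged into sums of nonnegative terms, whose integrals
   add without any finiteness. *)
have E : \int[mu]_x h^\+ x + \int[mu]_x (g x)%:E =
    \int[mu]_x (f x)%:E + \int[mu]_x h^\- x.
  rewrite -!ge0_integralD//.
  - apply: eq_integral => x _.
    rewrite funeposE funenegE /h -EFinN opprB -!EFin_max -!EFinD.
    congr EFin; case: (leP (f x) (g x)) => fg.
      by rewrite max_r ?max_l ?subr_le0 ?subr_ge0// add0r addrC subrK.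
    by rewrite max_l ?max_r ?subr_le0 ?subr_ge0 ?(ltW fg)// addr0 subrK.
  - by move=> x _; rewrite lee_fin.
  - exact/measurable_EFinP.
  - exact: measurable_funeneg.
  - exact: measurable_funepos.
  - by move=> x _; rewrite lee_fin.
  - exact/measurable_EFinP.
transitivity (\int[mu]_x h^\+ x - \int[mu]_x h^\- x); first exact: integralE.
move: E fin_g fin_h.
case: (\int[mu]_x (g x)%:E) => // b; case: (\int[mu]_x h^\- x) => // e.
case: (\int[mu]_x h^\+ x) => [a| |]; case: (\int[mu]_x (f x)%:E) => [c| |] //=.
by move=> [] H _ _; congr EFin; lra.
Qed.

(** Stated on an arbitrary measurable space, so that the analytic bounds can be proved without
    tuples. *)
Definition is_density_of (d : measure_display) (T : measurableType d)
    (R : realType) (mu nu : set T -> \bar R) (G : T -> R) :=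
  [/\ measurable_fun [set: T] G, (forall t, (0 <= G t)%R) &
      forall A, measurable A -> nu A = \int[mu]_(t in A) (G t)%:E].

(** The change of variables is known for the Radon-Nikodym derivative. [G] has the same integral
    over every measurable set, so the two agree [mu]-almost everywhere. *)
Lemma density_integral (d : measure_display) (T : measurableType d)
    (R : realType) (mu nu : probability T R) (G : T -> R) (f : T -> \bar R) :
  nu `<< mu -> is_density_of mu nu G ->
  measurable_fun [set: T] f -> (forall t, 0 <= f t) ->
  \int[nu]_t f t = \int[mu]_t (f t * (G t)%:E).
Proof.
move=> numu [mG G0 nuG] mf f0.
rewrite -(Radon_Nikodym_SigmaFinite.change_of_variables numu)//.
have mG' : measurable_fun setT (EFin \o G) by exact/measurable_EFinP.
have iRN := Radon_Nikodym_SigmaFinite.f_integrable numu.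
apply: ae_eq_integral => //.
- by apply: emeasurable_funM => //; exact: measurable_int iRN.
- exact: emeasurable_funM.
have : ae_eq mu setT (Radon_Nikodym_SigmaFinite.f nu mu) (EFin \o G).
  apply: integral_ae_eq => // E _ mE.
  transitivity (nu E); last exact: nuG.
  exact/esym/Radon_Nikodym_SigmaFinite.f_integral.
by apply: filterS => t /= /[apply] ->.
Qed.

(** * Pearson and divergence bounds from Hoelder's inequality *)

Lemma hoelder_set (d : measure_display) (T : measurableType d) (R : realType)
    (mu : {measure set T -> \bar R}) (f : T -> R) (A : set T) (p q : R) :
  measurable_fun [set: T] f -> measurable A ->
  (0 < p)%R -> (0 < q)%R -> (p^-1 + q^-1 = 1)%R ->
  \int[mu]_(x in A) (`|f x|)%:E <=
    (\int[mu]_x (`|f x| `^ p)%:E) `^ p^-1 * (mu A) `^ q^-1.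
Proof.
move=> mf mA p0 q0 pq.
have := hoelder mu mf (measurable_indic mA) p0 q0 pq.
rewrite Lnorm1 unlock /=.
rewrite [X in X <= _ -> _](_ : _ = \int[mu]_(x in A) (`|f x|)%:E); last first.
  rewrite [RHS]integral_mkcond; apply: eq_integral => x _.
  by rewrite patchE indicE normrM; case: (x \in A); rewrite ?normr1 ?normr0 ?mulr1 ?mulr0.
rewrite [X in _ * X `^ _](_ : _ = mu A)// -[in RHS](setIT A) -integral_indic//.
apply: eq_integral => x _; rewrite indicE.
by case: (x \in A); rewrite ?normr1 ?normr0 ?powR1 ?powR0 ?gt_eqF.
Qed.

Lemma probability_integral_cst (d : measure_display) (T : measurableType d)
    (R : realType) (mu : probability T R) (r : R) : \int[mu]__ r%:E = r%:E.
Proof. by rewrite integral_cst//= probability_setT mule1. Qed.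

Lemma density_le_pearson (d : measure_display) (T : measurableType d)
    (R : realType) (mu nu : probability T R) (G : T -> R) (A : set T) :
  is_density_of mu nu G -> measurable A ->
  nu A <= mu A + sqrte (\int[mu]_t ((G t) ^+ 2)%:E - 1) * sqrte (mu A).
Proof.
move=> [mG G0 nuG] mA.
have mG1 : measurable_fun setT (fun t => G t - 1)%R by exact: measurable_funB.
have variance : \int[mu]_t ((G t - 1) ^+ 2)%:E =
    \int[mu]_t ((G t) ^+ 2)%:E - 1.
  have intG : \int[mu]_t (2 * G t)%:E = 2%:E.
    under eq_integral do rewrite EFinM.
    rewrite ge0_integralZl//; last 2 first.
    - exact/measurable_EFinP.
    - by move=> t _; rewrite lee_fin.
    by rewrite -nuG// probability_setT mule1.
  (* The square is grouped as a difference of nonnegative functions, the second with integral 2, so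
     that [ge0_integralB] covers an infinite second moment too. *)
  transitivity (\int[mu]_t ((G t) ^+ 2 + 1 - 2 * G t)%:E).
    by apply: eq_integral => t _; congr EFin; ring.
  rewrite ge0_integralB ?intG ?ltry//.
  - under eq_integral do rewrite EFinD.
    rewrite ge0_integralD//; last 2 first.
    + by move=> t _; rewrite lee_fin sqr_ge0.
    + by apply/measurable_EFinP; exact: measurable_funX.
    rewrite probability_integral_cst.
    case: (\int[mu]_x _) => [r| |]//=.
    by rewrite -!EFinD; congr EFin; ring.
  - by apply: measurable_funD => //; exact: measurable_funX.
  - exact: measurable_funM.
  - by move=> t; rewrite addr_ge0// sqr_ge0.
  - by move=> t; rewrite mulr_ge0.
have half : (2^-1 + 2^-1 = 1 :> R)%R by lra.
have := hoelder_set mu mG1 mA (ltr0n R 2) (ltr0n R 2) half.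
rewrite [X in X `^ _](_ : _ = \int[mu]_t ((G t - 1) ^+ 2)%:E); last first.
  apply: eq_integral => t _.
  by rewrite powR_mulrn// -normrX ger0_norm ?sqr_ge0.
rewrite !poweR12_sqrt ?integral_ge0//; last first.
  by move=> t _; rewrite lee_fin sqr_ge0.
rewrite variance => H.
(* Integrating [G <= 1 + |G - 1|] over [A] bounds [nu A] by this middle term. *)
apply: (@le_trans _ _ (mu A + \int[mu]_(t in A) (`|G t - 1|)%:E)); last first.
  exact: leeD2l.
rewrite -[mu A]mul1e -integral_cst// nuG// -ge0_integralD//; last first.
  by apply/measurable_EFinP/measurable_funTS; exact: measurableT_comp.
apply: ge0_le_integral => //.
- by move=> t _; rewrite lee_fin.
- exact/measurable_EFinP/measurable_funTS.
- apply: emeasurable_funD => //.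
  by apply/measurable_EFinP/measurable_funTS; exact: measurableT_comp.
- by move=> t _; rewrite -EFinD lee_fin -lerBlDl ler_norm.
Qed.

Lemma density_le_power (d : measure_display) (T : measurableType d)
    (R : realType) (mu nu : probability T R) (G : T -> R) (A : set T) (q : R) :
  is_density_of mu nu G -> measurable A -> (1 < q)%R ->
  nu A <= (\int[mu]_t (`|G t| `^ (q / (q - 1)))%:E) `^ (1 - q^-1)
          * (mu A) `^ q^-1.
Proof.
move=> [mG G0 nuG] mA q1.
have q0 : (0 < q)%R by lra.
have q10 : (0 < q - 1)%R by lra.
(* [q / (q - 1)] is the Hoelder conjugate of [q]. *)
have pE : ((q / (q - 1))^-1 = 1 - q^-1)%R by field; rewrite !gt_eqF.
rewrite -pE; apply: le_trans (hoelder_set mu mG mA _ q0 _).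
- by rewrite nuG//; under [leRHS]eq_integral do rewrite ger0_norm//.
- exact: divr_gt0.
- by rewrite pE subrK.
Qed.

Lemma add1_sub1e (R : realType) (y : \bar R) : 1 + (y - 1) = y.
Proof. by case: y => [r| |]//; rewrite -!EFinD; congr EFin; ring. Qed.

(** Turns [1 + divergence] into the moment of [G] that Hoelder's inequality produces, also when that
    moment is infinite. *)
Lemma integral_subr1 (d : measure_display) (T : measurableType d)
    (R : realType) (mu : probability T R) (f : T -> R) :
  measurable_fun [set: T] f -> (forall t, (0 <= f t)%R) ->
  1 + \int[mu]_t (f t - 1)%:E = \int[mu]_t (f t)%:E.
Proof.
move=> mf f0; have mu1 := probability_integral_cst mu 1.
rewrite (@ge0_integralB _ _ _ mu f (cst 1%R)) ?mu1 ?ltry//.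
exact: add1_sub1e.
Qed.

(** * The relative entropy bound *)

Lemma density_le_entropy (d : measure_display) (T : measurableType d)
    (R : realType) (mu nu : probability T R) (G : T -> R) (A : set T) :
  nu `<< mu -> is_density_of mu nu G -> measurable A ->
  nu A <= (expR 1 - 1)%:E * mu A + \int[nu]_t lne (G t)%:E.
Proof.
move=> numu densG mA; have [mG G0 nuG] := densG.
(* [lne (G t)] is [-oo] where [G] vanishes; that set is [nu]-negligible, so
   [G] may be replaced there by [1]. *)
pose G' t := if (0 < G t)%R then G t else 1%R.
have G'0 t : (0 < G' t)%R by rewrite /G'; case: ifP.
have mlt : measurable_fun [set: T] (fun t => 0 < G t)%R.
  exact: measurable_fun_ltr.
pose h t := ln (G' t).
have mh : measurable_fun [set: T] h.
  by apply: measurableT_comp => //; exact: measurable_fun_ifT.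
have mN : measurable [set t | ~~ (0 < G t)%R].
  rewrite (_ : mkset _ = (fun t => 0 < G t)%R @^-1` [set false]).
    by rewrite -[X in measurable X]setTI; exact: mlt.
  by apply/seteqP; split => t /=; case: (0 < G t)%R.
have -> : \int[nu]_t lne (G t)%:E = \int[nu]_t (h t)%:E.
  apply: ae_eq_integral => //.
  - apply: measurable_fun_ifT => //; first exact: measurable_fun_ler.
    by apply/measurable_EFinP; exact: measurableT_comp.
  - exact/measurable_EFinP.
  exists [set t | ~~ (0 < G t)%R]; split => //.
  (* The [nu]-mass of this set is the integral over it of [G], which is 0 there. *)
  - apply: (etrans (nuG _ mN)); apply: integral0_eq => t /=; rewrite -leNgt => Gt.
    by congr EFin; apply/eqP; rewrite eq_le Gt G0.
  - move=> t /= /not_implyP[_]; apply: contra_notN => Gt.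
    by rewrite /h /G' Gt leNgt Gt.
(* This is [exp (1_A) / G']; the inequality [1 + u <= exp u] at [u = 1_A - h] gives [g_ge]. *)
pose g t := expR (\1_A t - h t)%R.
have mg : measurable_fun [set: T] g.
  by apply: measurableT_comp => //; exact: measurable_funB.
have g_ge t : (1 + \1_A t <= h t + g t)%R.
  by have := expR_ge1Dx (\1_A t - h t)%R; rewrite -/(g t); lra.
have ind0 t : (0 <= \1_A t :> R)%R by [].
have int_g : \int[nu]_t (g t)%:E <= 1 + (expR 1 - 1)%:E * mu A.
  rewrite (density_integral numu densG)//; last 2 first.
  - exact/measurable_EFinP.
  - by move=> t; rewrite lee_fin expR_ge0.
  have e1 : (0 <= expR 1 - 1 :> R)%R by have := expR_ge1Dx (1 : R)%R; lra.
  have -> : 1 + (expR 1 - 1)%:E * mu A =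
      \int[mu]_t (1 + (expR 1 - 1) * \1_A t)%:E.
    under [RHS]eq_integral do rewrite EFinD EFinM.
    rewrite ge0_integralD//.
    - rewrite probability_integral_cst ge0_integralZl// ?integral_indic ?setIT//.
      exact/measurable_EFinP.
    - by apply/measurable_EFinP; exact: measurable_funM.
  apply: ge0_le_integral => //.
  - by move=> t _; rewrite -EFinM lee_fin mulr_ge0// expR_ge0.
  - by apply: emeasurable_funM; exact/measurable_EFinP.
  - apply/measurable_EFinP; apply: measurable_funD => //.
    exact: measurable_funM.
  move=> t _; rewrite -EFinM lee_fin /g expRB lnK ?posrE//.
  (* [G <= G'] everywhere, so the factor [G / G'] is at most 1. *)
  apply: (@le_trans _ _ (expR (\1_A t))).
    rewrite -mulrA ger_pMr ?expR_gt0// ler_pdivrMl// mulr1 /G'.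
    by case: ltP => // /le_trans; apply.
  (* [exp (1_A) = 1 + (e - 1) * 1_A], since the indicator is 0 or 1. *)
  rewrite indicE; case: (t \in A); rewrite ?mulr1 ?mulr0.
    by rewrite addrC subrK.
  by rewrite expR0 addr0.
have int_f : 1 + nu A <= \int[nu]_t (h t + g t)%:E.
  have -> : 1 + nu A = \int[nu]_t (1 + \1_A t)%:E.
    under [RHS]eq_integral do rewrite EFinD.
    rewrite ge0_integralD// ?probability_integral_cst ?integral_indic ?setIT//.
    exact/measurable_EFinP.
  apply: ge0_le_integral => //.
  - by apply/measurable_EFinP; exact: measurable_funD.
  - by apply/measurable_EFinP; exact: measurable_funD.
  by move=> t _; rewrite lee_fin.
(* [h] may change sign, but [h + g] and [g] are nonnegative and [g] has a finite integral; the
   entropy may still be [+oo]. *)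
have -> : \int[nu]_t (h t)%:E = \int[nu]_t (h t + g t)%:E - \int[nu]_t (g t)%:E.
  rewrite -ge0_integralB//.
  - by apply: eq_integral => t _; rewrite addrK.
  - exact: measurable_funD.
  - by move=> t; apply: le_trans (g_ge t); rewrite addr_ge0.
  - by move=> t; exact: expR_ge0.
  - apply: le_lt_trans int_g _; rewrite -(fineK (fin_num_measure mu _ mA)).
    by rewrite -EFinM -EFinD ltry.
(* With finite [mu A] and [nu A] the claim is linear arithmetic, unless [h + g] has an infinite
   integral and the right side is [+oo]. *)
move: int_g int_f.
rewrite -(fineK (fin_num_measure mu _ mA)) -(fineK (fin_num_measure nu _ mA)).
rewrite -!EFinM -!EFinD.
have : 0 <= \int[nu]_t (g t)%:E.
  by apply: integral_ge0 => t _; rewrite lee_fin expR_ge0.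
case: (\int[nu]_t (g t)%:E) => [a| |]//=.
case: (\int[nu]_t (h t + g t)%:E) => [b| |]//=.
  by rewrite -!EFinD !lee_fin; lra.
by move=> _ _ _; exact: leey.
Qed.

(** * Transfer to random vectors *)

Theorem theorem7p5 (R : realType) (n : nat)
    (d : measure_display) (T : measurableType d) (P : probability T R)
    (X : 'I_n -> {RV P >-> R})
    (d' : measure_display) (T' : measurableType d') (P' : probability T' R)
    (xi : 'I_n -> {RV P' >-> R})
    (G : n.-tuple R -> R) (h : n.-tuple R -> R)
    (habs : joint_law X `<< marginal_product X)
    (hG : is_density X G)
    (hindep : independent_RVs xi)
    (hlaw : forall (k : 'I_n) (A : set R), measurable A ->
      distribution P' (xi k) A = distribution P (X k) A)
    (hh : measurable_fun [set: n.-tuple R] h) (x : R) :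
  let pX := P [set w | (x < h [tuple X i w | i < n])%R] in
  let pxi := P' [set w | (x < h [tuple xi i w | i < n])%R] in
  [/\ pX <= pxi + pearson X G * sqrte pxi,
      pX <= sqrte (1 + pearson2 X G) * sqrte pxi,
      pX <= (expR 1 - 1)%:E * pxi + relative_entropy X G &
      forall q : R, (1 < q)%R ->
        pX <= (1 + divergence X G (fun y => `|y| `^ (q / (q - 1)) - 1)%R)
                `^ (1 - q^-1) * pxi `^ q^-1].
Proof.
have densG : is_density_of (marginal_product X) (joint_law X) G by case: hG.
have [mG G0 _] := densG.
pose A := h @^-1` `]x, +oo[.
have mA : measurable A by rewrite /A -[X in measurable X]setTI; exact: hh.
have AE (S : Type) (Y : S -> n.-tuple R) :
    [set w | (x < h (Y w))%R] = Y @^-1` A.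
  by apply/seteqP; split => w; rewrite /A /= in_itv/= andbT.
have pXE : P [set w | (x < h [tuple X i w | i < n])%R] = joint_law X A.
  by rewrite (AE _ (random_vector X)).
have pxiE : P' [set w | (x < h [tuple xi i w | i < n])%R] =
    marginal_product X A.
  rewrite (AE _ (random_vector xi)).
  exact: (independent_joint_law hindep hlaw mA).
move=> pX pxi; rewrite /pX /pxi pXE pxiE; split.
- exact: density_le_pearson.
- rewrite /pearson2.
  (* The second bound is the power bound at [q = 2], its own conjugate exponent; cancelling the 1 is
     valid at [+oo] as well. *)
  have -> : 1 + (\int[marginal_product X]_t (G t ^+ 2)%:E - 1) =
      \int[marginal_product X]_t (`|G t| `^ (2 / (2 - 1)))%:E.
    rewrite (_ : 2 / (2 - 1) = 2)%R; last by field.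
    rewrite add1_sub1e; apply: eq_integral => t _.
    by rewrite powR_mulrn// ger0_norm.
  rewrite -!poweR12_sqrt ?integral_ge0//.
  have := density_le_power densG mA (ltr1n R 2).
  by rewrite (_ : (1 - 2^-1 = 2^-1 :> R)%R)//; lra.
- exact: density_le_entropy.
- move=> q q1; rewrite /divergence integral_subr1//.
  + exact: density_le_power.
  + by apply: (measurableT_comp (measurable_powR _)); exact: measurableT_comp.
Qed.
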